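(* Assume: (I) $\sigma(B)\subset\{0\}\cup[\delta,\infty)$ for some $\delta>0$; (II) $\dim\operatorname{Ker}B<\infty$; (III) $J\mathcal K\subset\mathcal V$; (IV) $H^*=H$. Then there is some $\varepsilon>0$ such that $$\sigma(H)\subset(-\infty,-\varepsilon]\cup\{0\}\cup[\varepsilon,\infty).$$
   Context: $\mathcal X$ is a complex Hilbert space; $J:\mathcal X\to\mathcal X$ is bounded with $J^*=-J$, $J^2=-1$; $B$ is a densely defined selfadjoint nonnegative operator in $\mathcal X$. $\Lambda:=B^{1/2}\ge0$; $\mathcal V\subset\mathcal X$ is the domain of $\Lambda$. $\mathcal K:=\operatorname{Ker}\Lambda=\operatorname{Ker}B$. $H:=\Lambda iJ\Lambda$ is the operator in $\mathcal X$ with domain $D(H)=\{Z\in\mathcal V: J\Lambda Z\in\mathcal V\}$. *)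

(* Defs.v *)
From HB Require Import structures.
From mathcomp Require Import all_boot all_order all_algebra.
From mathcomp Require Export complex.
From mathcomp Require Export all_classical all_reals all_analysis.

Set Implicit Arguments.
Unset Strict Implicit.
Unset Printing Implicit Defensive.

Import Order.TTheory GRing.Theory Num.Theory.
Import numFieldNormedType.Exports.

Local Open Scope classical_set_scope.
Local Open Scope complex_scope.
Local Open Scope ring_scope.

(* A complex Hilbert space is a complete normed module [X] over [R[i]] with an
   inner product, linear in its first argument, that induces the norm. *)
Definition induces_norm (R : realType) (X : completeNormedModType R[i])
    (dot : {dot X for Num.conj}) : Prop :=
  forall x : X, dot x x = `|x| ^+ 2.

(* A partially defined operator in [X]: only the values of [op_fun] on [dom]
   are meaningful, hence the extensional equality [op_eq]. *)
Record operator (R : realType) (X : completeNormedModType R[i]) :=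
  Operator { dom : set X; op_fun :> X -> X }.

Section Operators.
Context {R : realType} {X : completeNormedModType R[i]}.
Variable dot : {dot X for Num.conj}.
Implicit Types A B L : operator X.

Definition op_eq A B : Prop :=
  dom A = dom B /\ forall x, dom A x -> A x = B x.

Definition linear_op A : Prop :=
  dom A 0 /\
  forall (a : R[i]) (x y : X), dom A x -> dom A y ->
    dom A (a *: x + y) /\ A (a *: x + y) = a *: A x + A y.

Definition total_op (f : X -> X) : operator X := Operator setT f.

Definition bounded_map (f : X -> X) : Prop :=
  exists M : R, forall x, `|f x| <= M%:C * `|x|.

Definition densely_defined A : Prop := dense (dom A).

(* [z] is a value of the adjoint of [A] at [y]; it is unique if [A] is densely
   defined, and only then is [adjoint A] meaningful. *)
Definition adjoint_rel A (y z : X) : Prop :=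
  forall x, dom A x -> dot (A x) y = dot x z.

Definition adjoint A : operator X :=
  Operator [set y | exists z, adjoint_rel A y z]
           (fun y => xget 0 (adjoint_rel A y)).

Definition selfadjoint A : Prop :=
  [/\ linear_op A, densely_defined A & op_eq (adjoint A) A].

Definition nonnegative A : Prop :=
  forall x, dom A x -> 0 <= dot (A x) x.

Definition op_comp A B : operator X :=
  Operator [set x | dom B x /\ dom A (B x)] (A \o B).

(* [L] is the square root of [B], i.e. its (unique) nonnegative selfadjoint
   square root; [op_comp] makes the domains of [L^2] and [B] agree. *)
Definition is_sqrt B L : Prop :=
  [/\ selfadjoint L, nonnegative L & op_eq (op_comp L L) B].

Definition op_ker A : set X := [set x | dom A x /\ A x = 0].

Definition finite_dimensional (S : set X) : Prop :=
  exists (n : nat) (e : 'I_n -> X),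
    S = [set \sum_(i < n) c i *: e i | c in [set: 'I_n -> R[i]]].

Definition resolvent_set A : set R[i] :=
  [set z | exists S : {linear X -> X},
    [/\ bounded_map S,
        forall x, dom A (S x) /\ A (S x) - z *: S x = x
      & forall x, dom A x -> S (A x - z *: x) = x]].

Definition spectrum A : set R[i] := ~` resolvent_set A.

(* [H = L (i J) L]; as [dom L] is a subspace, the factor [i] plays no role in the
   domain. *)
Definition hamiltonian L (J : X -> X) : operator X :=
  Operator [set Z | dom L Z /\ dom L (J (L Z))]
           (fun Z => L ('i%C *: J (L Z))).

End Operators.

(* Main.v *)
(* Idea. Two facts about L = B^(1/2) are needed: |L y| >= c |y| for y in dom L
   orthogonal to K = Ker L, and Ran L is the orthogonal of K. The first is derived
   from the gap of B without the spectral theorem: the gap gives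
   |(B - d/2) x| >= (d/2) |x|, that is |B x|^2 >= d <B x, x> = d |L x|^2, and a
   limiting argument with the resolvents (B - m)^-1, m -> 0, transfers this to L.
   Next, H is bounded below on (Ker H)^perp: the only obstruction is the component of
   J L Z in K, where J compressed to the finite-dimensional K has closed range, and
   what its kernel contributes comes from Ker H. Finally a selfadjoint operator that is
   bounded below on the orthogonal of its kernel has no spectrum in a punctured
   neighbourhood of 0. *)
Require Import Defs.
From HB Require Import structures.
From mathcomp Require Import all_boot all_order all_algebra.
From mathcomp Require Import complex.
From mathcomp Require Import all_classical all_reals all_analysis.
From mathcomp Require Import ring lra.

Set Implicit Arguments.
Unset Strict Implicit.
Unset Printing Implicit Defensive.

Import Order.TTheory GRing.Theory Num.Theory.
Import numFieldNormedType.Exports.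

Local Open Scope classical_set_scope.
Local Open Scope complex_scope.
Local Open Scope ring_scope.

(** * Real-valued norm and real inner product of a complex Hilbert space *)

Section RealInnerProduct.
Context {R : realType} {X : completeNormedModType R[i]}.
Context (dot : {dot X for Num.conj}) (hdot : induces_norm dot).
Implicit Types (x y z : X) (r : R) (a : R[i]).

(** The norm of [X] takes values in [R[i]]; passing to its real part lets estimates live in the
    ordered field [R]. *)
Definition nrm x : R := complex.Re `|x|.
Definition rdot x y : R := complex.Re (dot x y).

Lemma norm_nrm x : `|x| = (nrm x)%:C.
Proof. by rewrite /nrm RRe_real // ger0_real. Qed.

Lemma nrm_ge0 x : 0 <= nrm x.
Proof. by rewrite -ler0c -norm_nrm. Qed.

Lemma nrm0 : nrm 0 = 0.
Proof. by rewrite /nrm normr0. Qed.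

Lemma nrm_eq0 x : (nrm x == 0) = (x == 0).
Proof. by rewrite -[RHS]normr_eq0 norm_nrm (inj_eq (@complexI R) _ 0). Qed.

Lemma nrm_gt0 x : (0 < nrm x) = (x != 0).
Proof. by rewrite lt_def nrm_eq0 nrm_ge0 andbT. Qed.

Lemma nrmN x : nrm (- x) = nrm x.
Proof. by rewrite /nrm normrN. Qed.

Lemma nrmD x y : nrm (x + y) <= nrm x + nrm y.
Proof.
by rewrite -lecR -norm_nrm rmorphD /= -!norm_nrm ler_normD.
Qed.

Lemma nrmB x y : nrm (x - y) <= nrm x + nrm y.
Proof. by rewrite -(nrmN y) nrmD. Qed.

Lemma nrmZ a x : nrm (a *: x) = complex.Re `|a| * nrm x.
Proof.
rewrite /nrm normrZ (norm_nrm x) normc_def /=.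
by rewrite mul0r subr0.
Qed.

Lemma nrmZr r x : nrm (r%:C *: x) = `|r| * nrm x.
Proof. by rewrite nrmZ normc_def /= expr0n addr0 sqrtr_sqr. Qed.

Lemma nrm_i x : nrm ('i%C *: x) = nrm x.
Proof. by rewrite nrmZ normc_def /= expr0n add0r expr1n sqrtr1 mul1r. Qed.

Lemma nrm_sum n (e : 'I_n -> X) :
  nrm (\sum_i e i) <= \sum_i nrm (e i).
Proof.
elim/big_rec2: _ => [|i r x _ h]; first by rewrite nrm0.
exact: le_trans (nrmD _ _) (lerD _ h).
Qed.

Lemma bounded_nrm (f : X -> X) :
  bounded_map f <-> exists2 M : R, 0 <= M & forall x, nrm (f x) <= M * nrm x.
Proof.
split=> [[M hM]|[M _ hM]]; last first.
  by exists M => x; rewrite !norm_nrm -rmorphM /= lecR.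
exists `|M| => // x; have := hM x; rewrite !norm_nrm -rmorphM /= lecR => h.
by apply: le_trans h _; rewrite ler_wpM2r ?nrm_ge0 // ler_norm.
Qed.

Lemma dotC x y : dot x y = (dot y x)^*%C.
Proof. by rewrite hermC expr0 mul1r. Qed.

Lemma rdotC x y : rdot x y = rdot y x.
Proof. by rewrite /rdot dotC; case: (dot y x). Qed.

Lemma rdotDl x y z : rdot (x + y) z = rdot x z + rdot y z.
Proof. by rewrite /rdot linearDl raddfD. Qed.

Lemma rdotNl x y : rdot (- x) y = - rdot x y.
Proof. by rewrite /rdot linearNl raddfN. Qed.

Lemma rdotBl x y z : rdot (x - y) z = rdot x z - rdot y z.
Proof. by rewrite rdotDl rdotNl. Qed.

Lemma rdotDr x y z : rdot x (y + z) = rdot x y + rdot x z.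
Proof. by rewrite rdotC rdotDl !(rdotC x). Qed.

Lemma rdotNr x y : rdot x (- y) = - rdot x y.
Proof. by rewrite rdotC rdotNl (rdotC x). Qed.

Lemma rdotBr x y z : rdot x (y - z) = rdot x y - rdot x z.
Proof. by rewrite rdotDr rdotNr. Qed.

Lemma rdotZl r x y : rdot (r%:C *: x) y = r * rdot x y.
Proof. by rewrite /rdot linearZl_LR /=; case: (dot x y) => u v /=; ring. Qed.

Lemma rdotZr r x y : rdot x (r%:C *: y) = r * rdot x y.
Proof. by rewrite rdotC rdotZl rdotC. Qed.

Lemma rdot0l x : rdot 0 x = 0.
Proof. by rewrite /rdot linear0l. Qed.

Lemma rdot0r x : rdot x 0 = 0.
Proof. by rewrite rdotC rdot0l. Qed.

Lemma rdot_il x y : rdot ('i%C *: x) y = - complex.Im (dot x y).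
Proof. by rewrite /rdot linearZl_LR /=; case: (dot x y) => u v /=; ring. Qed.

Lemma rdot_ir x y : rdot x ('i%C *: y) = complex.Im (dot x y).
Proof. by rewrite rdotC rdot_il dotC; case: (dot x y) => u v /=; ring. Qed.

Lemma rdot_i x y : rdot ('i%C *: x) y = - rdot x ('i%C *: y).
Proof. by rewrite rdot_il rdot_ir. Qed.

Lemma rdotZ a x y : rdot (a *: x) y = rdot x (a^*%C *: y).
Proof.
have hl : dot (a *: x) y = a * dot x y by rewrite linearZl_LR.
have hr : dot (a^*%C *: y) x = a^*%C * dot y x by rewrite linearZl_LR.
rewrite /rdot hl (dotC x (_ *: _)) hr (dotC x y).
by case: a {hl hr} (dot y x) => a b [u v] /=; ring.
Qed.

(** Real identities tested against both [y] and [i y] thus give complex ones. *)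
Lemma dot_rdot x y : dot x y = rdot x y +i* rdot x ('i%C *: y).
Proof. by rewrite rdot_ir /rdot; case: (dot x y). Qed.

Lemma rdotxx x : rdot x x = nrm x ^+ 2.
Proof. by rewrite /rdot hdot norm_nrm -rmorphXn. Qed.

Lemma nrmD_sqr x y : nrm (x + y) ^+ 2 = nrm x ^+ 2 + 2 * rdot x y + nrm y ^+ 2.
Proof. by rewrite -!rdotxx !(rdotDl, rdotDr) (rdotC y x); ring. Qed.

Lemma nrmB_sqr x y : nrm (x - y) ^+ 2 = nrm x ^+ 2 - 2 * rdot x y + nrm y ^+ 2.
Proof. by rewrite nrmD_sqr rdotNr nrmN; ring. Qed.

Lemma pythagoras x y : rdot x y = 0 -> nrm (x + y) ^+ 2 = nrm x ^+ 2 + nrm y ^+ 2.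
Proof. by rewrite nrmD_sqr => ->; ring. Qed.

(** Cauchy-Schwarz, from expanding the squared norm of [|y| x - |x| y]. *)
Lemma rdot_le x y : rdot x y <= nrm x * nrm y.
Proof.
have [->|y0] := eqVneq y 0; first by rewrite rdot0r nrm0 mulr0.
have [->|x0] := eqVneq x 0; first by rewrite rdot0l nrm0 mul0r.
have hx : 0 < nrm x by rewrite nrm_gt0.
have hy : 0 < nrm y by rewrite nrm_gt0.
have := sqr_ge0 (nrm ((nrm y)%:C *: x - (nrm x)%:C *: y)).
rewrite nrmB_sqr !nrmZr rdotZl rdotZr !ger0_norm ?nrm_ge0 // => h.
by rewrite -(ler_pM2l (mulr_gt0 hx hy)); lra.
Qed.

Lemma normr_rdot_le x y : `|rdot x y| <= nrm x * nrm y.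
Proof.
by rewrite ler_norml rdot_le andbT lerNl -rdotNl (le_trans (rdot_le _ _)) ?nrmN.
Qed.

End RealInnerProduct.

Lemma small_eq0 (R : realType) (t c : R) :
  (forall e, 0 < e -> `|t| <= c * e) -> t = 0.
Proof.
move=> h; apply/eqP; rewrite -normr_le0; apply/ler_addgt0Pr => e e0; rewrite add0r.
have c0 : 0 < `|c| + 1 by rewrite ltr_wpDl.
apply: le_trans (h (e / (`|c| + 1)) (divr_gt0 e0 c0)) _.
rewrite mulrCA -[leRHS]mulr1 ler_pM2l // ler_pdivrMr // mul1r.
by rewrite (le_trans (ler_norm c)) // lerDl.
Qed.

(** * Orthogonal projection onto the closure of a subspace *)

Section Projection.
Context {R : realType} {X : completeNormedModType R[i]}.
Context (dot : {dot X for Num.conj}) (hdot : induces_norm dot).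
Implicit Types (x y z : X) (S : set X).

Local Notation nrm := (@nrm R X).
Local Notation rdot := (rdot dot).

Lemma complex_gt0P (a : R[i]) : 0 < a -> exists2 e : R, 0 < e & a = e%:C.
Proof.
move=> a0; have aE : (complex.Re a)%:C = a by rewrite RRe_real ?gtr0_real.
by exists (complex.Re a) => //; rewrite -ltcR aE.
Qed.

(** Points chosen in [F (1 / (n + 1))] form a Cauchy sequence. The sets need not be closed, so the
    limit [l] is only approximated by points of each [F d]. *)
Lemma complete_nested (F : R -> set X) :
  (forall e : R, 0 < e -> F e !=set0) ->
  (forall e e' : R, e <= e' -> F e `<=` F e') ->
  (forall e : R, 0 < e ->
     exists2 d, 0 < d & forall x y, F d x -> F d y -> nrm (x - y) < e) ->
  exists l, forall e d : R, 0 < e -> 0 < d -> exists2 x, F d x & nrm (l - x) < e.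
Proof.
move=> F0 Fmono Fdiam.
have /choice[u uF] : forall n : nat, exists x, F (n.+1%:R^-1) x.
  by move=> n; apply: F0; rewrite invr_gt0.
have uFd d : 0 < d -> \forall n \near \oo, F d (u n).
  move=> d0; have := near_infty_natSinv_lt (PosNum d0).
  by apply: filterS => n /ltW /Fmono; apply.
have : cauchy (u @ \oo).
  apply/cauchy_exP => _ /complex_gt0P[e e0 ->].
  have [d d0 dP] := Fdiam e e0.
  have [N _ NF] := uFd d d0; exists (u N); exists N => // n nN.
  rewrite -ball_normE /= norm_nrm ltcR dP //; apply: NF => //=.
move=> /cauchy_cvgP/cvg_ex[l /= ul]; exists l => e d e0 d0.
have {}ul : \forall n \near \oo, `|l - u n| < e%:C.
  by move/cvgrPdist_lt: ul; apply; rewrite ltcR.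
have [n [nF nl]] : exists n, F d (u n) /\ `|l - u n| < e%:C.
  exact: (@filter_ex _ \oo _ _ (filterI (uFd d d0) ul)).
by exists (u n) => //; rewrite -ltcR -norm_nrm.
Qed.

Definition subspace S := S 0 /\ forall (a : R[i]) x y, S x -> S y -> S (a *: x + y).

Definition close_to S x := forall e : R, 0 < e -> exists2 s, S s & nrm (x - s) < e.

Lemma subspaceD S x y : subspace S -> S x -> S y -> S (x + y).
Proof. by case=> _ Slin Sx Sy; rewrite -[x]scale1r; apply: Slin. Qed.

Lemma subspaceZ S (a : R[i]) x : subspace S -> S x -> S (a *: x).
Proof. by case=> S0 Slin Sx; rewrite -[a *: x]addr0; apply: Slin. Qed.

Lemma subspaceN S x : subspace S -> S x -> S (- x).
Proof. by move=> hS Sx; rewrite -scaleN1r; apply: subspaceZ. Qed.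

Lemma subspaceB S x y : subspace S -> S x -> S y -> S (x - y).
Proof. by move=> hS Sx Sy; apply: subspaceD => //; apply: subspaceN. Qed.

Lemma close_to_rdot0 S x y : close_to S x -> (forall s, S s -> rdot y s = 0) ->
  rdot y x = 0.
Proof.
move=> hx hy; apply: (@small_eq0 _ _ (nrm y)) => e e0.
have [s Ss sx] := hx e e0.
have -> : rdot y x = rdot y (x - s) by rewrite rdotBr (hy s Ss) subr0.
apply: le_trans (normr_rdot_le hdot _ _) _.
by rewrite ler_wpM2l ?nrm_ge0 // ltW.
Qed.

(** Near minimisers of the distance from [x] to [S] form a nested family of shrinking diameter, with
    limit [p]. As [S] need not be closed, [p] is only found in its closure. *)
Lemma projection S x : subspace S ->
  exists2 p, close_to S p & forall s, S s -> rdot (x - p) s = 0.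
Proof.
move=> hS; have [S0 _] := hS.
pose E := [set nrm (x - s) ^+ 2 | s in S]; pose d := inf E.
have E0 : has_inf E.
  split; first by exists (nrm (x - 0) ^+ 2), 0.
  by exists 0 => _ [s _ <-]; rewrite sqr_ge0.
have dle s : S s -> d <= nrm (x - s) ^+ 2.
  by move=> Ss; apply: ge_inf; [case: E0|exists s].
pose F (e : R) := [set s | S s /\ nrm (x - s) ^+ 2 <= d + e].
(* perturbing a near minimiser [s] along [t] decreases the squared distance by
   at most [e], which bounds the component of [x - s] along [t] *)
have Fdot (e : R) s t : 0 < e -> F e s -> S t -> rdot (x - s) t ^+ 2 <= e * nrm t ^+ 2.
  move=> e0 [Ss sd] St; have [->|t0] := eqVneq t 0.
    by rewrite rdot0r nrm0 !expr0n mulr0.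
  have n0 : 0 < nrm t ^+ 2 by rewrite exprn_gt0 ?nrm_gt0.
  pose r := rdot (x - s) t / nrm t ^+ 2.
  have := dle (s + r%:C *: t) (subspaceD hS Ss (subspaceZ _ hS St)).
  rewrite opprD addrA (nrmB_sqr hdot) rdotZr nrmZr exprMn real_normK ?num_real //.
  have rE : r * nrm t ^+ 2 = rdot (x - s) t by rewrite /r divfK ?gt_eqF.
  rewrite [r ^+ 2]expr2 -[r * r * _]mulrA rE => h.
  have {}h : r * rdot (x - s) t <= e by lra.
  by rewrite expr2 -{1}rE mulrAC ler_pM2r.
have [e e0|e e' ee s []|e e0|p pP] := @complete_nested F.
- have [_ [s Ss <-] sd] := inf_adherent e0 E0.
  by exists s; split => //; apply: ltW.
- by split=> //; lra.
- exists (e ^+ 2 / 8); first by rewrite divr_gt0 ?exprn_gt0.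
  move=> s t Fs Ft; have Sst : S (s - t) by apply: subspaceB => //; [case: Fs|case: Ft].
  have e80 : 0 < e ^+ 2 / 8 by rewrite divr_gt0 ?exprn_gt0.
  have := Fdot _ _ _ e80 Fs Sst; have := Fdot _ _ _ e80 Ft Sst.
  rewrite !rdotBl; set a := rdot x _; set b := rdot t _; set c := rdot s _.
  have -> : nrm (s - t) ^+ 2 = c - b by rewrite -(rdotxx hdot) rdotBl.
  have : c - b = nrm (s - t) ^+ 2 by rewrite -(rdotxx hdot) rdotBl.
  move=> nE h1 h2.
  (* By [(u - v)^2 <= 2 (u^2 + v^2)], where each square is at most [(e^2 / 8) |s - t|^2]; hence
     [|s - t|^2 <= e^2 / 2]. *)
  have cb : (c - b) ^+ 2 <= (e ^+ 2 / 2) * (c - b).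
    have -> : c - b = (a - b) - (a - c) by ring.
    have := sqr_ge0 ((a - b) + (a - c)); lra.
  have [->|st] := eqVneq s t; first by rewrite subrr nrm0.
  have n0 : 0 < nrm (s - t) ^+ 2 by rewrite exprn_gt0 ?nrm_gt0 ?subr_eq0.
  rewrite -(ltr_pXn2r (n := 2)) ?nnegrE ?nrm_ge0 ?ltW //.
  move: cb; rewrite nE expr2 ler_pM2r // => cb.
  by apply: le_lt_trans cb _; have := exprn_gt0 2 e0; lra.
exists p => [e e0|t St].
  by have [s [Ss _] ps] := pP e 1 e0 ltr01; exists s.
apply: (@small_eq0 _ _ (2 * nrm t)) => e e0.
have [s Fs ps] := pP e (e ^+ 2) e0 (exprn_gt0 2 e0).
have -> : rdot (x - p) t = rdot (x - s) t - rdot (p - s) t.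
  by rewrite -rdotBl opprB addrA subrK.
have h1 : `|rdot (x - s) t| <= e * nrm t.
  have et0 : 0 <= e * nrm t by rewrite mulr_ge0 ?nrm_ge0 ?ltW.
  rewrite -(ler_pXn2r (n := 2)) ?nnegrE // real_normK ?num_real // exprMn.
  by apply: Fdot => //; rewrite exprn_gt0.
have h2 : `|rdot (p - s) t| <= e * nrm t.
  apply: le_trans (normr_rdot_le hdot _ _) _.
  by rewrite ler_wpM2r ?nrm_ge0 // ltW.
apply: le_trans (ler_normB _ _) _; lra.
Qed.

End Projection.

(** * Selfadjoint operators: closedness, kernel, range and resolvent *)

Section SelfAdjoint.
Context {R : realType} {X : completeNormedModType R[i]}.
Context (dot : {dot X for Num.conj}) (hdot : induces_norm dot).
Implicit Types (x y w : X) (K : set X) (z : R[i]).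

Local Notation nrm := (@nrm R X).
Local Notation rdot := (rdot dot).

(** For a complex subspace this is complex orthogonality, since the subspace is stable under [i]. *)
Definition orth K : set X := [set x | forall k, K k -> rdot x k = 0].

Lemma subspace_orth K : subspace K -> subspace (orth K).
Proof.
move=> hK; split=> [k _|a x y hx hy k Kk]; first by rewrite rdot0l.
rewrite rdotDl hy // addr0.
by rewrite rdotZ hx //; apply: subspaceZ.
Qed.

Section Operator.
Context (A : operator X) (A_sa : selfadjoint dot A).

Definition op_range : set X := [set A x | x in dom A].

Lemma dom_subspace : subspace (dom A).
Proof.
have [[d0 dA] _ _] := A_sa; split=> // a x y dx dy.
by have [] := dA a x y dx dy.
Qed.

Lemma domD x y : dom A x -> dom A y -> dom A (x + y).
Proof. exact: subspaceD dom_subspace. Qed.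

Lemma domZ (a : R[i]) x : dom A x -> dom A (a *: x).
Proof. exact: subspaceZ dom_subspace. Qed.

Lemma domN x : dom A x -> dom A (- x).
Proof. exact: subspaceN dom_subspace. Qed.

Lemma domB x y : dom A x -> dom A y -> dom A (x - y).
Proof. exact: subspaceB dom_subspace. Qed.

Lemma dom0 : dom A 0.
Proof. by case: dom_subspace. Qed.

Lemma op_linear (a : R[i]) x y : dom A x -> dom A y -> A (a *: x + y) = a *: A x + A y.
Proof. by have [[_ dA] _ _] := A_sa => dx dy; have [] := dA a x y dx dy. Qed.

Lemma opD x y : dom A x -> dom A y -> A (x + y) = A x + A y.
Proof. by move=> dx dy; rewrite -[x]scale1r op_linear // !scale1r. Qed.

Lemma op0 : A 0 = 0.
Proof.
by apply: (@addIr _ (A 0)); rewrite -opD ?addr0 ?add0r //; apply: dom0.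
Qed.

Lemma opZ (a : R[i]) x : dom A x -> A (a *: x) = a *: A x.
Proof.
by move=> dx; rewrite -[a *: x]addr0 op_linear ?op0 ?addr0 //; apply: dom0.
Qed.

Lemma opN x : dom A x -> A (- x) = - A x.
Proof. by move=> dx; rewrite -scaleN1r opZ // scaleN1r. Qed.

Lemma opB x y : dom A x -> dom A y -> A (x - y) = A x - A y.
Proof. by move=> dx dy; rewrite opD ?opN //; apply: domN. Qed.

Lemma shift_linear z (a : R[i]) x y : dom A x -> dom A y ->
  A (a *: x + y) - z *: (a *: x + y) = a *: (A x - z *: x) + (A y - z *: y).
Proof.
move=> dx dy; rewrite op_linear // scalerDr opprD addrACA; congr (_ + _).
by rewrite scalerBr !scalerA mulrC.
Qed.

Lemma shiftB z x y : dom A x -> dom A y ->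
  A (x - y) - z *: (x - y) = (A x - z *: x) - (A y - z *: y).
Proof.
move=> dx dy; rewrite opB // scalerBr !opprB addrACA [RHS]addrACA.
by congr (_ + _); apply: addrC.
Qed.

Lemma dom_dense x : close_to (dom A) x.
Proof.
have [_ Adense _] := A_sa; move=> e e0.
have [|y [yb yA]] := Adense (ball x e%:C) _ (ball_open x e%:C).
  by exists x; apply: ballxx; rewrite ltcR.
exists y => //; move: yb; rewrite -ball_normE /=.
by rewrite norm_nrm ltcR.
Qed.

Lemma op_sym x y : dom A x -> dom A y -> rdot (A x) y = rdot x (A y).
Proof.
have [_ _ [domE opE]] := A_sa; move=> dx dy.
have dy' : dom (adjoint dot A) y by rewrite domE.
rewrite -(opE y dy') /= /rdot; case: dy' => z yz.
by congr complex.Re; have := xgetPex 0 (ex_intro _ z yz); apply.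
Qed.

(** The adjoint has no larger domain than [A]. The real identity suffices: replacing [x] by [i x]
    supplies the imaginary part, and density of the domain identifies the value. *)
Lemma op_maximal y w : (forall x, dom A x -> rdot (A x) y = rdot x w) ->
  dom A y /\ A y = w.
Proof.
have [_ _ [domE opE]] := A_sa; move=> hy.
have yw : adjoint_rel dot A y w.
  move=> x dx; rewrite !dot_rdot hy //; congr (_ +i* _).
  apply: oppr_inj; rewrite -!rdot_i -hy ?opZ //.
  exact: domZ.
have dy' : dom (adjoint dot A) y by exists w.
have dy : dom A y by rewrite -domE.
split=> //; apply/eqP; rewrite -subr_eq0 -nrm_eq0 -sqrf_eq0 -(rdotxx hdot).
apply/eqP; apply: close_to_rdot0 (dom_dense _) _ => // x dx.
by rewrite rdotC rdotBr -hy // op_sym // subrr.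
Qed.

(** A limit of points of the graph still satisfies the symmetry relation against all of [dom A], so
    maximality applies. *)
Lemma op_closed x w :
  (forall e : R, 0 < e ->
     exists2 u, dom A u & nrm (x - u) < e /\ nrm (w - A u) < e) ->
  dom A x /\ A x = w.
Proof.
move=> h; apply: op_maximal => v dv; apply/eqP; rewrite -subr_eq0; apply/eqP.
apply: (@small_eq0 _ _ (nrm (A v) + nrm v)) => e e0.
have [u du [xu wu]] := h e e0.
have -> : rdot (A v) x - rdot v w = rdot (A v) (x - u) - rdot v (w - A u).
  by rewrite !rdotBr (op_sym dv du); ring.
apply: le_trans (ler_normB _ _) _; rewrite mulrDl lerD //.
  by apply: le_trans (normr_rdot_le hdot _ _) _; rewrite ler_wpM2l ?nrm_ge0 // ltW.
by apply: le_trans (normr_rdot_le hdot _ _) _; rewrite ler_wpM2l ?nrm_ge0 // ltW.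
Qed.

Lemma ker_subspace : subspace (op_ker A).
Proof.
split=> [|a x y [dx x0] [dy y0]]; first by split; [apply: dom0|apply: op0].
split; first by apply: domD => //; apply: domZ.
by rewrite op_linear // x0 y0 scaler0 addr0.
Qed.

Lemma ker_projection x : exists2 p, op_ker A p & orth (op_ker A) (x - p).
Proof.
have [p hp xp] := projection hdot x ker_subspace; exists p => //.
apply: op_closed => e e0; have [s [ds s0] ps] := hp e e0.
by exists s => //; rewrite s0 subrr nrm0.
Qed.

Lemma range_subspace : subspace op_range.
Proof.
split=> [|a _ _ [x dx <-] [y dy <-]]; first by exists 0; [apply: dom0|apply: op0].
exists (a *: x + y); last by rewrite op_linear.
by apply: domD => //; apply: domZ.
Qed.

(** The residual [y - p] of the projection on the closed range is orthogonal to the range, hence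
    lies in the kernel. Both [y] and [p] are orthogonal to the kernel, so the residual is orthogonal
    to itself. *)
Lemma orth_ker_range y : orth (op_ker A) y -> close_to op_range y.
Proof.
move=> yK; have [p hp yp] := projection hdot y range_subspace.
have rK : op_ker A (y - p).
  apply: op_maximal => x dx; rewrite rdot0r rdotC yp //.
  by exists x.
suff -> : y = p by [].
apply/eqP; rewrite -subr_eq0 -nrm_eq0 -sqrf_eq0 -(rdotxx hdot) rdotBr.
by rewrite rdotC yK // (close_to_rdot0 hdot hp) // subrr.
Qed.

Lemma range_orth_ker x k : dom A x -> op_ker A k -> rdot (A x) k = 0.
Proof. by move=> dx [dk k0]; rewrite op_sym // k0 rdot0r. Qed.

(** The lower bound makes approximate solutions a Cauchy family; closedness of [A] and of [orth K]
    handles the limit. Used with [K] zero for resolvents and with [K = Ker L] for the range of the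
    square root. *)
Lemma closed_range K z (c : R) w : subspace K -> 0 < c ->
  (forall x, dom A x -> orth K x -> c * nrm x <= nrm (A x - z *: x)) ->
  close_to [set A x - z *: x | x in dom A `&` orth K] w ->
  exists x, [/\ dom A x, orth K x & A x - z *: x = w].
Proof.
move=> hK c0 hc hw; have hO := subspace_orth hK.
pose F (e : R) := [set x | [/\ dom A x, orth K x & nrm (w - (A x - z *: x)) <= e]].
have [e e0|e e' ee s [ds Ks se]|e e0|l hl] := @complete_nested _ _ F.
- by have [_ [x [dx Kx] <-] xe] := hw e e0; exists x; split=> //; apply: ltW.
- by split=> //; apply: le_trans ee.
- exists (c * e / 3); first by rewrite divr_gt0 ?mulr_gt0.
  move=> x y [dx Kx hx] [dy Ky hy].
  rewrite -(ltr_pM2l c0); apply: le_lt_trans (hc _ (domB dx dy) (subspaceB hO Kx Ky)) _.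
  have -> : A (x - y) - z *: (x - y) = (w - (A y - z *: y)) - (w - (A x - z *: x)).
    by rewrite shiftB // (opprB w) [RHS]addrC subrKA.
  apply: le_lt_trans (nrmB _ _) _.
  have : 0 < c * e by rewrite mulr_gt0.
  lra.
have lK : orth K l.
  move=> k Kk; rewrite rdotC; apply: (@close_to_rdot0 _ _ _ hdot (orth K)) => [e e0|s sK].
    by have [x [_ Kx _] lx] := hl e 1 e0 ltr01; exists x.
  by rewrite rdotC sK.
pose m := complex.Re `|z|; have m0 : 0 <= m by rewrite /m normc_def /= sqrtr_ge0.
have [dl Al] : dom A l /\ A l = w + z *: l.
  (* With this [d], the error [d + |z| d] is [e / 2]. *)
  apply: op_closed => e e0; pose d := e / (2 * (m + 1)).
  have m1 : 0 < 2 * (m + 1) by lra.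
  have d0 : 0 < d by rewrite divr_gt0.
  have de : d * (2 * (m + 1)) = e by rewrite /d divfK // gt_eqF.
  have dm : 0 <= d * m by rewrite mulr_ge0 // ltW.
  have [x [dx _ hx] lx] := hl d d d0 d0; exists x => //; split; first by lra.
  have -> : w + z *: l - A x = (w - (A x - z *: x)) + z *: (l - x).
    by rewrite scalerBr opprB -[RHS]addrA [_ - _ + (_ - _)]addrC subrKA addrA.
  apply: le_lt_trans (nrmD _ _) _; rewrite nrmZ -/m.
  have : m * nrm (l - x) <= m * d by rewrite ler_wpM2l // ltW.
  lra.
by exists l; split=> //; rewrite Al addrK.
Qed.

(** The bound at [z] gives injectivity and closed range. The orthogonal of the range is the kernel
    of [A] minus the conjugate of [z], which the second bound makes trivial. *)
Lemma resolvent_bounded_below z (c : R) : 0 < c ->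
  (forall x, dom A x -> c * nrm x <= nrm (A x - z *: x)) ->
  (forall x, dom A x -> c * nrm x <= nrm (A x - z^*%C *: x)) ->
  resolvent_set A z.
Proof.
move=> c0 hc hc'.
have inj x y : dom A x -> dom A y -> A x - z *: x = A y - z *: y -> x = y.
  move=> dx dy xy; apply/eqP; rewrite -subr_eq0 -nrm_eq0 eq_le nrm_ge0 andbT.
  rewrite -(ler_pM2l c0) mulr0; apply: le_trans (hc _ (domB dx dy)) _.
  by rewrite shiftB // xy subrr nrm0.
have surj w : exists x, dom A x /\ A x - z *: x = w.
  have h0 : subspace [set 0 : X].
    by split=> // a x y -> ->; rewrite /= scaler0 addr0.
  have h0T x : orth [set 0] x by move=> k ->; rewrite rdot0r.
  have hS : subspace [set A x - z *: x | x in dom A `&` orth [set 0]].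
    split; first by exists 0; rewrite ?op0 ?scaler0 ?subrr //; split=> //; apply: dom0.
    move=> a _ _ [x [dx _] <-] [y [dy _] <-]; exists (a *: x + y).
      by split=> //; apply: domD => //; apply: domZ.
    exact: shift_linear.
  have [p hp wp] := projection hdot w hS.
  have [x [dx _ xp]] := closed_range h0 c0 (fun x dx _ => hc x dx) hp.
  have [dr r0] : dom A (w - p) /\ A (w - p) = z^*%C *: (w - p).
    apply: op_maximal => u du; apply/eqP; rewrite -rdotZ -subr_eq0 -rdotBl rdotC.
    by rewrite wp //; exists u.
  exists x; split=> //; apply/eqP; rewrite xp eq_sym -subr_eq0 -nrm_eq0.
  rewrite eq_le nrm_ge0 andbT.
  by rewrite -(ler_pM2l c0) mulr0; apply: le_trans (hc' _ dr) _; rewrite r0 subrr nrm0.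
have /choice[f fP] := surj.
have flin : linear f.
  move=> a x y; have [dx fx] := fP x; have [dy fy] := fP y; have [d e] := fP (a *: x + y).
  apply: inj => //; first by apply: domD => //; apply: domZ.
  by rewrite e shift_linear // fx fy.
pose S : {linear X -> X} := HB.pack f (GRing.isLinear.Build _ _ _ _ f flin).
exists S; split=> [|x|x dx]; last 2 first.
- exact: fP.
- by have [d e] := fP (A x - z *: x); apply: inj.
apply/bounded_nrm; exists c^-1; first by rewrite invr_ge0 ltW.
move=> x; have [dx fx] := fP x.
by rewrite mulrC ler_pdivlMr // mulrC -{2}fx hc.
Qed.

Lemma resolvent_nrm z : resolvent_set A z ->
  exists2 c : R, 0 < c & forall x, dom A x -> c * nrm x <= nrm (A x - z *: x).
Proof.
move=> [S [/bounded_nrm[M M0 hM] _ SA]].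
have M1 : 0 < M + 1 by rewrite ltr_wpDl.
exists (M + 1)^-1 => [|x dx]; first by rewrite invr_gt0.
rewrite mulrC ler_pdivrMr // -{1}(SA x dx) mulrC.
by apply: le_trans (hM _) _; rewrite ler_wpM2r ?nrm_ge0 // lerDl.
Qed.

(** For [z = a + i b], symmetry makes [(A - a) x] and [i b x] orthogonal for the real product, so
    the squared norm of the difference is at least [b^2 |x|^2]. *)
Lemma nonreal_bounded_below z x : dom A x ->
  `|complex.Im z| * nrm x <= nrm (A x - z *: x).
Proof.
move=> dx; rewrite -(ler_pXn2r (n := 2)) ?nnegrE ?mulr_ge0 ?nrm_ge0 //.
rewrite exprMn real_normK ?num_real //.
case: z => a b /=; have -> : (a +i* b) *: x = a%:C *: x + b%:C *: ('i%C *: x).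
  by rewrite scalerA -scalerDl; congr (_ *: _); simpc.
rewrite opprD addrA (nrmB_sqr hdot) nrmZr exprMn real_normK ?num_real // nrm_i.
have ix : rdot x ('i%C *: x) = 0.
  by have := rdot_i dot x x; rewrite rdotC; lra.
have iAx : rdot (A x) ('i%C *: x) = 0.
  have := rdot_i dot (A x) x; rewrite -opZ // op_sym // ?(opZ _ dx); last exact: domZ.
  by rewrite rdotC; have := rdot_i dot (A x) x; lra.
by rewrite rdotZr rdotBl rdotZl ix iAx; have := sqr_ge0 (nrm (A x - a%:C *: x)); lra.
Qed.

Lemma resolvent_nonreal z : complex.Im z != 0 -> resolvent_set A z.
Proof.
move=> z0; apply: (@resolvent_bounded_below z `|complex.Im z|).
- by rewrite normr_gt0.
- exact: nonreal_bounded_below.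
- move=> x dx; have := nonreal_bounded_below z^*%C dx.
  by case: z {z0} => a b /=; rewrite normrN.
Qed.

End Operator.
End SelfAdjoint.

(** * Transfer of the spectral gap from [B] to its square root *)

Section SpectralGap.
Context {R : realType} {X : completeNormedModType R[i]}.
Context (dot : {dot X for Num.conj}) (hdot : induces_norm dot).
Context (B : operator X) (B_sa : selfadjoint dot B).
Implicit Types (x y w : X) (r m : R).

Local Notation nrm := (@nrm R X).
Local Notation rdot := (rdot dot).

(* The norm of the bounded symmetric [S = (B - m)^-1] is attained in its spectrum:
   if [M = |S|^2], then [M |y|^2 - |S y|^2] is not bounded below, so one of
   [m +- 1 / sqrt M] lies in the spectrum of [B]. *)
Lemma dist_spectrum_bounded_below m r : 0 < r ->
  (forall t : R, `|t| < r -> resolvent_set B (m + t)%:C) ->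
  forall x, dom B x -> r * nrm x <= nrm (B x - m%:C *: x).
Proof.
move=> r0 hr x0 dx0; rewrite leNgt; apply/negP => lt0.
have := hr 0; rewrite normr0 addr0 => /(_ r0) [S [Sb SP SK]].
have [M0 M00 hM0] := (bounded_nrm S).1 Sb.
pose E := [set nrm (S x) ^+ 2 | x in [set x | nrm x <= 1]]; pose M := sup E.
have E_sup : has_sup E.
  split; first by exists (nrm (S 0) ^+ 2), 0; rewrite /= ?nrm0 ?ler01.
  exists (M0 ^+ 2) => _ [x /= x1 <-]; rewrite ler_pXn2r ?nnegrE ?nrm_ge0 //.
  by apply: le_trans (hM0 x) _; rewrite ler_piMr.
have hM x : nrm (S x) ^+ 2 <= M * nrm x ^+ 2.
  have [->|x_neq0] := eqVneq x 0; first by rewrite linear0 !nrm0 expr0n mulr0.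
  have nx : 0 < nrm x by rewrite nrm_gt0.
  have : nrm (S ((nrm x)^-1%:C *: x)) ^+ 2 <= M.
    apply: sup_ubound; first by case: E_sup.
    exists ((nrm x)^-1%:C *: x) => //=.
    by rewrite nrmZr ger0_norm ?invr_ge0 ?nrm_ge0 // mulVf ?gt_eqF.
  rewrite linearZ /= nrmZr exprMn real_normK ?num_real // exprVn mulrC.
  by rewrite ler_pdivrMr // exprn_gt0.
pose y0 := B x0 - m%:C *: x0.
have Sy0 : S y0 = x0 by apply: SK.
have ny0 : 0 < nrm y0.
  rewrite nrm_gt0; apply/eqP => y00; move: lt0.
  by rewrite -/y0 -Sy0 y00 linear0 nrm0 mulr0 ltxx.
(* The assumed failure of the bound at [x0] forces [r^2 M > 1], so that [a = 1 / sqrt M] falls below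
   [r]. *)
have rM : 1 < r ^+ 2 * M.
  rewrite -(ltr_pM2r (exprn_gt0 2 ny0)) mul1r -mulrA.
  apply: lt_le_trans (_ : (r * nrm (S y0)) ^+ 2 <= _); last first.
    by rewrite exprMn ler_pM2l ?exprn_gt0.
  by rewrite ltr_pXn2r ?nnegrE ?mulr_ge0 ?nrm_ge0 ?(ltW r0) // Sy0.
have M_gt0 : 0 < M.
  by rewrite -(pmulr_rgt0 _ (exprn_gt0 2 r0)); apply: lt_trans rM.
pose a := Num.sqrt M^-1.
have a0 : 0 < a by rewrite sqrtr_gt0 invr_gt0.
have a2 : a ^+ 2 = M^-1 by rewrite sqr_sqrtr // invr_ge0 ltW.
have ar : a < r.
  rewrite -(ltr_pXn2r (n := 2)) ?nnegrE ?ltW // a2 -[M^-1]mul1r ltr_pdivrMr //.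
(* Since [y - t S y = (B - m - t) (S y)], the resolvent at [m + t] bounds [1 - t S] from below. *)
have bb t : `|t| = a ->
    exists2 k : R, 0 < k & forall y, k * nrm y <= nrm (y - t%:C *: S y).
  move=> ta; have [|c c0 hc] := resolvent_nrm (hr t _); first by rewrite ta.
  exists (1 + a / c)^-1 => [|y].
    by rewrite invr_gt0 addr_gt0 // divr_gt0.
  have k0 : 0 < 1 + a / c by rewrite addr_gt0 // divr_gt0.
  rewrite mulrC ler_pdivrMr //.
  have [dS BS] := SP y.
  have := hc _ dS; rewrite rmorphD /= scalerDl opprD addrA BS => hcy.
  have -> : nrm y = nrm ((y - t%:C *: S y) + t%:C *: S y) by rewrite subrK.
  apply: le_trans (nrmD _ _) _; rewrite nrmZr ta mulrDr mulr1 lerD2l.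
  have := ler_wpM2l (ltW (divr_gt0 a0 c0)) hcy.
  by rewrite mulrA divfK ?gt_eqF // [leRHS]mulrC.
have [k1 k10 hk1] := bb a (gtr0_norm a0).
have [k2 k20 hk2] : exists2 k : R, 0 < k & forall y, k * nrm y <= nrm (y + a%:C *: S y).
  have [|k k0 hk] := bb (- a); first by rewrite normrN gtr0_norm.
  by exists k => // y; have := hk y; rewrite rmorphN scaleNr opprK.
pose k := k1 * k2; have k0 : 0 < k by rewrite mulr_gt0.
have Ssym x y : rdot (S x) y = rdot x (S y).
  have [dx {2}<-] := SP x; have [dy {1}<-] := SP y.
  by rewrite rdotBl rdotBr rdotZl rdotZr (op_sym B_sa).
(* Factor [1 - a^2 S^2 = (1 - a S) (1 + a S)]. *)
have hk y : k * nrm y <= nrm (y - (a ^+ 2)%:C *: S (S y)).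
  have -> : y - (a ^+ 2)%:C *: S (S y) =
      (y + a%:C *: S y) - a%:C *: S (y + a%:C *: S y).
    have -> : S (y + a%:C *: S y) = S y + a%:C *: S (S y) by rewrite linearD linearZ.
    by rewrite scalerDr scalerA -rmorphM -expr2 opprD addrA addrK.
  apply: le_trans (hk1 _); rewrite /k -mulrA ler_pM2l //.
(* After squaring, symmetry of [S] turns the cross term into [- 2 a^2 |S y|^2], and [a^2 M = 1]
   bounds the last term by [a^2 |S y|^2]. *)
have nk y : k ^+ 2 * nrm y ^+ 2 <= nrm y ^+ 2 - a ^+ 2 * nrm (S y) ^+ 2.
  have : (k * nrm y) ^+ 2 <= nrm (y - (a ^+ 2)%:C *: S (S y)) ^+ 2.
    by rewrite ler_pXn2r ?nnegrE ?nrm_ge0 ?hk // mulr_ge0 ?nrm_ge0 // ltW.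
  rewrite (nrmB_sqr hdot) rdotZr -Ssym (rdotxx hdot) nrmZr !exprMn.
  rewrite real_normK ?num_real //.
  have : (a ^+ 2) ^+ 2 * nrm (S (S y)) ^+ 2 <= a ^+ 2 * nrm (S y) ^+ 2.
    rewrite [X in X * _]expr2 -mulrA ler_pM2l ?exprn_gt0 // {1}a2 mulrC.
    by rewrite ler_pdivrMr // mulrC.
  lra.
have k_le1 : k ^+ 2 <= 1.
  rewrite -(ler_pM2r (exprn_gt0 2 ny0)) mul1r; apply: le_trans (nk y0) _.
  by rewrite gerBl mulr_ge0 // sqr_ge0.
(* So [|S y|^2 <= M (1 - k^2)] on the unit ball, which contradicts [M] being the supremum. *)
have Mk : M <= M * (1 - k ^+ 2).
  apply: sup_le_ub; first by case: E_sup.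
  move=> _ [y /= y1 <-].
  have y2 : nrm y ^+ 2 <= 1 by rewrite expr_le1 ?nrm_ge0.
  apply: (@le_trans _ _ (M * ((1 - k ^+ 2) * nrm y ^+ 2))).
    rewrite mulrC -ler_pdivrMr // -a2; have := nk y; lra.
  by rewrite ler_pM2l // ler_piMr // subr_ge0.
have := mulr_gt0 M_gt0 (exprn_gt0 2 k0); lra.
Qed.

Context (delta : R) (delta_gt0 : 0 < delta).
Context (B_spectrum : spectrum B `<=` [set x%:C | x in [set 0] `|` `[delta, +oo[ ]).

Lemma gap_resolvent m : 0 < m -> m < delta -> resolvent_set B m%:C.
Proof.
move=> m0 md; apply: contrapT => /B_spectrum[t /= ht /complexI tm].
move: ht; rewrite {}tm => -[m_0|]; first by rewrite m_0 ltxx in m0.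
by rewrite in_itv /= andbT leNgt md.
Qed.

Lemma gap_form x : dom B x -> delta * rdot (B x) x <= nrm (B x) ^+ 2.
Proof.
move=> dx; have d2 : 0 < delta / 2 by rewrite divr_gt0.
(* The open interval of radius [delta / 2] about [delta / 2] is exactly the gap. *)
have h : delta / 2 * nrm x <= nrm (B x - (delta / 2)%:C *: x).
  apply: dist_spectrum_bounded_below => // t.
  by rewrite ltr_norml => /andP[t1 t2]; apply: gap_resolvent; lra.
have : (delta / 2 * nrm x) ^+ 2 <= nrm (B x - (delta / 2)%:C *: x) ^+ 2.
  by rewrite ler_pXn2r ?nnegrE ?nrm_ge0 // mulr_ge0 ?nrm_ge0 // ltW.
rewrite (nrmB_sqr hdot) rdotZr nrmZr [X in _ <= _ + X]exprMn real_normK ?num_real //.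
by rewrite exprMn; lra.
Qed.

Context (L : operator X) (L_sqrt : is_sqrt dot B L).

Lemma sqrt_sa : selfadjoint dot L.
Proof. by case: L_sqrt. Qed.

Lemma sqrtE x : dom B x -> [/\ dom L x, dom L (L x) & L (L x) = B x].
Proof.
have [_ _ [domE LE]] := L_sqrt => dx.
have [d1 d2] : dom (op_comp L L) x by rewrite domE.
by split=> //; rewrite -LE.
Qed.

Lemma ker_sqrt : op_ker B = op_ker L.
Proof.
have [_ _ [domE LE]] := L_sqrt; apply/seteqP; split=> x [dx x0].
  have [d1 d2 LLx] := sqrtE dx; split=> //.
  apply/eqP; rewrite -nrm_eq0 -sqrf_eq0 -(rdotxx hdot) (op_sym sqrt_sa) //.
  by rewrite LLx x0 rdot0r.
have dd : dom (op_comp L L) x by split; rewrite //= x0; apply: dom0 sqrt_sa.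
by split; rewrite -?domE // -LE //= x0 (op0 sqrt_sa).
Qed.

(* [y] is tested against the solution [x] of [B x - m x = y], for which [m x] stays
   bounded and tends weakly to [0] on the closure of the range of [B] as [m -> 0]. *)
Lemma sqrt_gap y : dom L y -> orth dot (op_ker L) y ->
  Num.sqrt delta * nrm y <= 2 * nrm (L y).
Proof.
move=> dy; rewrite -ker_sqrt => yK.
set s := Num.sqrt delta.
have s0 : 0 < s by rewrite sqrtr_gt0.
have s2 : s ^+ 2 = delta by rewrite sqr_sqrtr // ltW.
have [->|y_neq0] := eqVneq y 0; first by rewrite nrm0 mulr0 mulr_ge0 // nrm_ge0.
have ny : 0 < nrm y by rewrite nrm_gt0.
apply/ler_addgt0Pr => e' e'0; pose e := e' / (2 * s).
have e0 : 0 < e by rewrite divr_gt0 // mulr_gt0.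
have -> : e' = 2 * s * e by rewrite /e mulrC divfK // gt_eqF // mulr_gt0.
have [_ [v dv <-] yv] := orth_ker_range hdot B_sa yK e0.
(* The first bound on [m] will give [m |x| <= |y|]; the second gives [2 m |v| <= e]. *)
pose m := Num.min (delta / 2) (e / (2 * (nrm v + 1))).
have nv1 : 0 < 2 * (nrm v + 1) by have := nrm_ge0 v; lra.
have m0 : 0 < m by rewrite lt_min; apply/andP; split; rewrite divr_gt0.
have m_delta : m <= delta / 2 by rewrite ge_min lexx.
have m_e : m * (2 * (nrm v + 1)) <= e.
  by rewrite -ler_pdivlMr // ge_min lexx orbT.
have [S [_ SP _]] : resolvent_set B m%:C by apply: gap_resolvent => //; lra.
have [dx xE] := SP y; set x := S y in dx xE.
have [dLx dLLx LLx] := sqrtE dx.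
have BxE : B x = y + m%:C *: x by rewrite -xE subrK.
have Bxx : rdot (B x) x = nrm (L x) ^+ 2.
  by rewrite -LLx (op_sym sqrt_sa) // (rdotxx hdot).
have gx := gap_form dx.
(* By the gap, [|B x - m x|^2] is at least [(delta - 2 m) <B x, x> + m^2 |x|^2]. *)
have mx : m * nrm x <= nrm y.
  rewrite -(ler_pXn2r (n := 2)) ?nnegrE ?nrm_ge0 ?mulr_ge0 ?nrm_ge0 ?(ltW m0) //.
  rewrite -xE (nrmB_sqr hdot) rdotZr nrmZr [X in _ <= _ + X]exprMn.
  rewrite real_normK ?num_real //.
  have : m * rdot (B x) x <= (delta / 2) * rdot (B x) x.
    by rewrite ler_wpM2r // Bxx sqr_ge0.
  rewrite exprMn; lra.
have nBx : nrm (B x) <= 2 * nrm y.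
  rewrite BxE; apply: le_trans (nrmD _ _) _; rewrite nrmZr gtr0_norm //; lra.
have nLx : s * nrm (L x) <= 2 * nrm y.
  apply: le_trans nBx.
  rewrite -(ler_pXn2r (n := 2)) ?nnegrE ?nrm_ge0 ?mulr_ge0 ?nrm_ge0 ?(ltW s0) //.
  by rewrite exprMn s2 -Bxx.
(* Pair [y = B x - m x] with [y]; in the term with [m], write [y = (y - B v) + B v] and move [B]
   from [v] to [x]. *)
have nyE : nrm y ^+ 2 = rdot (L y) (L x) - m * rdot (y - B v) x - m * rdot v (B x).
  rewrite (op_sym sqrt_sa dy dLLx) LLx -(op_sym B_sa dv dx) BxE.
  by rewrite !(rdotDl, rdotDr, rdotNl) -(rdotxx hdot) rdotZr; ring.
have h1 : s * rdot (L y) (L x) <= nrm (L y) * (2 * nrm y).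
  apply: (@le_trans _ _ (s * (nrm (L y) * nrm (L x)))).
    by rewrite ler_pM2l // rdot_le.
  by rewrite mulrCA ler_wpM2l ?nrm_ge0.
have h2 : - (m * rdot (y - B v) x) <= e * nrm y.
  apply: (@le_trans _ _ (m * (e * nrm x))).
    rewrite -mulrN ler_pM2l // -rdotNl.
    apply: le_trans (rdot_le hdot _ _) _; rewrite nrmN.
    by rewrite ler_wpM2r ?nrm_ge0 // ltW.
  by rewrite mulrCA ler_pM2l.
have h3 : - (m * rdot v (B x)) <= e * nrm y.
  apply: (@le_trans _ _ (m * (nrm v * (2 * nrm y)))).
    rewrite -mulrN ler_pM2l // -rdotNl.
    apply: le_trans (rdot_le hdot _ _) _; rewrite nrmN.
    by rewrite ler_wpM2l ?nrm_ge0.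
  rewrite !mulrA ler_pM2r // -mulrA; apply: le_trans m_e.
  by rewrite ler_pM2l //; lra.
rewrite -(ler_pM2r ny).
have : s * nrm y ^+ 2 <= nrm (L y) * (2 * nrm y) + s * (e * nrm y) + s * (e * nrm y).
  rewrite nyE !mulrBr; have := ler_wpM2l (ltW s0) h2; have := ler_wpM2l (ltW s0) h3.
  lra.
lra.
Qed.

(** The range of [L] is dense in the orthogonal of the kernel, and the gap makes it closed. *)
Lemma sqrt_range w : orth dot (op_ker L) w ->
  exists x, [/\ dom L x, orth dot (op_ker L) x & L x = w].
Proof.
move=> wK; have L_sa := sqrt_sa.
have s2 : 0 < Num.sqrt delta / 2 by rewrite divr_gt0 // sqrtr_gt0.
have [x dx xK|e e0|x [dx xK]] :=
  @closed_range _ _ _ hdot _ L_sa (op_ker L) 0 _ w (ker_subspace L_sa) s2.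
- rewrite scale0r subr0; have := sqrt_gap dx xK; lra.
- have [_ [x dx <-] we] := orth_ker_range hdot L_sa wK e0.
  (* Subtracting the kernel component of an approximate preimage leaves its image unchanged. *)
  have [p [dp p0] xp] := ker_projection hdot L_sa x.
  exists (L x) => //; exists (x - p); first by split=> //; apply: (domB L_sa dx dp).
  by rewrite scale0r subr0 (opB L_sa) // p0 subr0.
by rewrite scale0r subr0 => <-; exists x.
Qed.

End SpectralGap.

(** On a spanning family the compression of [J] to [K] is the matrix [G]; its pseudo-inverse gives a
    solution of size controlled by [u]. As [G] may be singular, some solution [k] is presupposed. *)
Lemma finite_compression_bound (R : realType) (X : completeNormedModType R[i])
    (dot : {dot X for Num.conj}) (J : {linear X -> X}) (K : set X) :
  induces_norm dot -> finite_dimensional K ->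
  exists2 C : R, 0 <= C & forall k u, K k ->
    (forall s, K s -> rdot dot (J k) s = rdot dot u s) ->
    exists k', [/\ K k', forall s, K s -> rdot dot (J k') s = rdot dot u s
                 & nrm k' <= C * nrm u].
Proof.
move=> hdot [n [e KE]].
pose G := \matrix_(i < n, j < n) dot (J (e i)) (e j).
pose lc (c : 'I_n -> R[i]) := \sum_(i < n) c i *: e i.
have K_lc c : K (lc c) by rewrite KE; exists c.
have Ke j : K (e j).
  rewrite KE; exists (fun i => (i == j)%:R) => //.
  rewrite (bigD1 j) //= eqxx scale1r big1 ?addr0 // => i /negPf ->.
  by rewrite scale0r.
have KZ (a : R[i]) x : K x -> K (a *: x).
  rewrite KE => -[c _ <-]; exists (fun i => a * c i) => //.
  by rewrite scaler_sumr; apply: eq_bigr => i _; rewrite scalerA.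
have dot_lc c j : dot (J (lc c)) (e j) = ((\row_i c i) *m G) 0 j.
  rewrite /lc linear_sum linear_sumlz mxE; apply: eq_bigr => i _.
  by rewrite !mxE linearZ /= linearZl_LR.
have dot_sumr x (b : 'I_n -> R[i]) :
    dot x (\sum_(j < n) b j *: e j) = \sum_(j < n) (b j)^*%C * dot x (e j).
  by rewrite linear_sumr; apply: eq_bigr => j _; rewrite linearZr_LR.
pose P := pinvmx G.
(* The factor 2 pays for bounding [|<u, e_j>|] by its real and imaginary parts. *)
pose C := \sum_(i < n) (\sum_(j < n) 2 * nrm (e j) * complex.Re `|P j i|) * nrm (e i).
exists C.
  apply: sumr_ge0 => i _; rewrite mulr_ge0 ?nrm_ge0 //; apply: sumr_ge0 => j _.
  by rewrite !mulr_ge0 ?nrm_ge0 // normc_def /= sqrtr_ge0.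
move=> k u Kk hk.
pose g := \row_j dot u (e j).
pose c i := (g *m P) 0 i.
(* The coefficients of [k] solve the linear system: testing against [e_j] and [i e_j] makes the real
   identity complex. *)
have gG : (g <= G)%MS.
  move: Kk hk; rewrite {1}KE => -[b _ <-] hk.
  suff -> : g = (\row_i b i) *m G by apply: submxMl.
  apply/rowP => j; rewrite -dot_lc mxE !dot_rdot -!hk //.
  exact: KZ.
have cE : \row_i c i = g *m P by apply/rowP => i; rewrite mxE.
exists (lc c); split=> //.
  rewrite KE => _ [b _ <-]; rewrite /rdot !dot_sumr.
  by congr complex.Re; apply: eq_bigr => j _; rewrite dot_lc cE mulmxKpV // mxE.
apply: le_trans (nrm_sum _) _; rewrite /C mulr_suml; apply: ler_sum => i _.
rewrite nrmZ mulrAC ler_wpM2r ?nrm_ge0 //.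
rewrite -lecR; apply: (@le_trans _ _ `|c i|).
  by rewrite RRe_real // ger0_real.
rewrite /c mxE; apply: le_trans (ler_norm_sum _ _ _) _.
rewrite mulr_suml rmorph_sum /=; apply: ler_sum => j _.
rewrite normrM mxE.
rewrite [X in _ <= X](_ : _ = (2 * (nrm u * nrm (e j)))%:C * `|P j i|); last first.
  rewrite -[in RHS](@RRe_real _ `|P j i|) ?ger0_real // -rmorphM /=; congr _%:C; ring.
rewrite ler_wpM2r // dot_rdot (complexE (_ +i* _)) /=; apply: le_trans (ler_normD _ _) _.
have nC (t : R) : `|t%:C| = `|t|%:C by rewrite normc_def /= expr0n addr0 sqrtr_sqr.
have ni : `|'i%C : R[i]| = 1 by rewrite normc_def /= expr0n add0r expr1n sqrtr1.
rewrite normrM ni mul1r !nC -rmorphD lecR.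
have h1 := normr_rdot_le hdot u (e j).
have := normr_rdot_le hdot u ('i%C *: e j); rewrite nrm_i; lra.
Qed.

(** * Lower bounds for the Hamiltonian away from its kernel *)

Section Hamiltonian.
Context {R : realType} {X : completeNormedModType R[i]}.
Context (dot : {dot X for Num.conj}) (hdot : induces_norm dot).
Context (J : {linear X -> X}) (J_sqr : forall x, J (J x) = - x).
Context (L : operator X) (L_sa : selfadjoint dot L).

Local Notation nrm := (@nrm R X).
Local Notation rdot := (rdot dot).
Local Notation K := (op_ker L).
Local Notation H := (hamiltonian L J).

(* Write [J L Z = W0 + W1] with [W0] in [K] and [W1] orthogonal to [K], so that
   [|H Z| = |L W1|] controls [W1]. Up to an element [k'] of size [O(|W1|)], [W0] is some
   [n] in [K] with [J n] orthogonal to [K]; the solution [Y] of [L Y = J n] then lies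
   in [Ker H], hence is orthogonal to [Z], and [|Z| <= |Z + Y| = O(|W1|)]. *)
Lemma hamiltonian_gap (c : R) : 0 < c -> bounded_map J -> finite_dimensional K ->
  (forall y, dom L y -> orth dot K y -> c * nrm y <= nrm (L y)) ->
  (forall w, orth dot K w -> exists x, [/\ dom L x, orth dot K x & L x = w]) ->
  exists2 D : R, 0 < D &
    forall Z, dom H Z -> orth dot (op_ker H) Z -> nrm Z <= D * nrm (H Z).
Proof.
move=> c0 /bounded_nrm[M M0 hM] Kfin Lgap Lrange.
have [C C0 hC] := finite_compression_bound J hdot Kfin.
(* [|J (W1 + k')| <= M (1 + C M) |W1|]; one division by [c] serves to bound [Z + Y], the other to
   bound [W1]. *)
pose D := M * (1 + C * M) / c / c.
have CM0 : 0 <= C * M by rewrite mulr_ge0.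
have D0 : 0 <= D by rewrite !divr_ge0 ?(ltW c0) // mulr_ge0 // addr_ge0.
exists (D + 1) => [|Z [dZ dJLZ] ZH]; first by rewrite ltr_wpDl.
have K_H k : K k -> op_ker H k.
  move=> [dk k0]; split; first by split; rewrite // k0 linear0; apply: dom0 L_sa.
  by rewrite /= k0 linear0 scaler0 (op0 L_sa).
have ZK : orth dot K Z by move=> k Kk; apply: ZH; apply: K_H.
pose W := J (L Z); have dW : dom L W by [].
have [W0 KW0 W1K] := ker_projection hdot L_sa W.
set W1 := W - W0 in W1K.
have [dW0 LW0] := KW0.
have dW1 : dom L W1 by apply: (domB L_sa).
have HZ : nrm (H Z) = nrm (L W1).
  by rewrite /= (opZ L_sa) // nrm_i /W1 (opB L_sa) // LW0 subr0.
have WE : W = W0 + W1 by rewrite addrC subrK.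
have JW : J W0 + J W1 = - L Z by rewrite -linearD -WE J_sqr.
(* [J W0 + J W1 = - L Z] is orthogonal to [K], so [W0] itself solves the compressed equation with
   right-hand side [- J W1]. *)
have [k' [Kk' k'K nk']] : exists k', [/\ K k',
    forall s, K s -> rdot (J k') s = rdot (- J W1) s & nrm k' <= C * nrm (- J W1)].
  apply: (hC W0) => // s Ks.
  have -> : J W0 = - L Z - J W1 by rewrite -JW addrK.
  by rewrite rdotBl rdotNl (range_orth_ker L_sa) // oppr0 add0r rdotNl.
pose n := W0 - k'.
have Kn : K n by apply: subspaceB (ker_subspace L_sa) _ _.
have JnK : orth dot K (J n).
  move=> s Ks; rewrite linearB rdotBl k'K //.
  have -> : J W0 = - L Z - J W1 by rewrite -JW addrK.
  by rewrite rdotBl !rdotNl (range_orth_ker L_sa) // oppr0 add0r opprK addNr.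
have [Y [dY YK LY]] := Lrange _ JnK.
(* [J L Y = J (J n) = - n] lies in [K], where [L] vanishes. *)
have YH : op_ker H Y.
  have JLY : J (L Y) = - n by rewrite LY J_sqr.
  have [dn n0] := Kn.
  split; first by split=> //; rewrite JLY; apply: (domN L_sa).
  rewrite /= JLY (opZ L_sa) ?(opN L_sa) ?n0 ?oppr0 ?scaler0 //.
  exact: (domN L_sa).
(* [J W0] cancels between [L Z] and [J n]. *)
have LZY : L (Z + Y) = - J (W1 + k').
  rewrite (opD L_sa) // LY /n linearB linearD -[L Z]opprK -JW.
  by rewrite !opprD addrACA addNr add0r.
have ZYK : orth dot K (Z + Y).
  exact: subspaceD (subspace_orth _ (ker_subspace L_sa)) ZK YK.
have nZ : nrm Z <= nrm (Z + Y).
  rewrite -(ler_pXn2r (n := 2)) ?nnegrE ?nrm_ge0 // (pythagoras hdot) ?ZH //.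
  by rewrite lerDl sqr_ge0.
have nW1 : c * nrm W1 <= nrm (H Z) by rewrite HZ; apply: Lgap.
have nZY : c * nrm (Z + Y) <= M * (1 + C * M) * nrm W1.
  apply: le_trans (Lgap _ (domD L_sa dZ dY) ZYK) _.
  rewrite LZY nrmN; apply: le_trans (hM _) _; rewrite -mulrA ler_wpM2l //.
  apply: le_trans (nrmD _ _) _; rewrite mulrDl mul1r lerD2l.
  apply: le_trans nk' _; rewrite nrmN -mulrA ler_wpM2l //.
have {}nZY : nrm Z <= D * nrm (H Z).
  apply: le_trans nZ _; rewrite -(ler_pM2l c0); apply: le_trans nZY _.
  have -> : c * (D * nrm (H Z)) = M * (1 + C * M) * (nrm (H Z) / c).
    by rewrite /D; field; rewrite gt_eqF.
  rewrite ler_wpM2l ?mulr_ge0 ?addr_ge0 // ler_pdivlMr //.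
  by rewrite mulrC.
by apply: le_trans nZY _; rewrite mulrDl lerDl mul1r nrm_ge0.
Qed.

(* Pythagoras along [X = Ker H + (Ker H)^perp]. *)
Lemma gap_bounded_below (A : operator X) (A_sa : selfadjoint dot A) (D a : R) :
  0 < D -> a != 0 -> `|a| < D^-1 ->
  (forall x, dom A x -> orth dot (op_ker A) x -> nrm x <= D * nrm (A x)) ->
  exists2 c : R, 0 < c & forall x, dom A x -> c * nrm x <= nrm (A x - a%:C *: x).
Proof.
(* On the kernel [A - a] is multiplication by [- a]; on its orthogonal, [|A x| >= |x| / D] leaves
   [1 / D - |a|]. *)
move=> D0 a0 aD hD; pose c := Num.min `|a| (D^-1 - `|a|).
have c0 : 0 < c by rewrite lt_min normr_gt0 a0 subr_gt0.
exists c => // x dx.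
have [x0 [d0 Ax0] x1K] := ker_projection hdot A_sa x.
set x1 := x - x0 in x1K; have d1 : dom A x1 by apply: (domB A_sa).
have xE : x = x1 + x0 by rewrite subrK.
have h1 : c * nrm x1 <= nrm (A x1 - a%:C *: x1).
  have hx1 : nrm x1 / D <= nrm (A x1) by rewrite ler_pdivrMr // mulrC hD.
  have : nrm (A x1) <= nrm (A x1 - a%:C *: x1) + `|a| * nrm x1.
    by rewrite -nrmZr -{1}[A x1](subrK (a%:C *: x1)) nrmD.
  have : c * nrm x1 <= (D^-1 - `|a|) * nrm x1.
    by rewrite ler_wpM2r ?nrm_ge0 // ge_min lexx orbT.
  lra.
have h0 : c * nrm x0 <= nrm (- (a%:C *: x0)).
  by rewrite nrmN nrmZr ler_wpM2r ?nrm_ge0 // ge_min lexx.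
have eE : A x - a%:C *: x = (A x1 - a%:C *: x1) - a%:C *: x0.
  by rewrite {1 2}xE (opD A_sa) // Ax0 addr0 scalerDr opprD addrA.
have x10 : rdot x1 x0 = 0 by apply: x1K.
(* The two images stay orthogonal because the range of [A] is orthogonal to its kernel. *)
have ort : rdot (A x1 - a%:C *: x1) (- (a%:C *: x0)) = 0.
  rewrite rdotNr rdotZr rdotBl rdotZl x10 (range_orth_ker A_sa) //.
  by rewrite mulr0 subr0 mulr0 oppr0.
rewrite -(ler_pXn2r (n := 2)) ?nnegrE ?nrm_ge0 ?mulr_ge0 ?nrm_ge0 ?(ltW c0) //.
rewrite eE (pythagoras hdot ort) exprMn {1}xE (pythagoras hdot x10).
rewrite mulrDr -!exprMn.
by rewrite lerD // ler_pXn2r ?nnegrE ?nrm_ge0 ?mulr_ge0 ?nrm_ge0 ?(ltW c0).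
Qed.

End Hamiltonian.

Theorem theorem2p3 (R : realType) (X : completeNormedModType R[i])
    (dot : {dot X for Num.conj}) (hdot : induces_norm dot)
    (J : {linear X -> X}) (J_bounded : bounded_map J)
    (J_adj : op_eq (adjoint dot (total_op J)) (total_op (fun x => - J x)))
    (J_sqr : forall x, J (J x) = - x)
    (B : operator X) (B_sa : selfadjoint dot B) (B_ge0 : nonnegative dot B)
    (L : operator X) (L_sqrt : is_sqrt dot B L)
    (hI : exists delta : R, 0 < delta /\
       spectrum B `<=` [set x%:C | x in [set 0] `|` `[delta, +oo[ ])
    (hII : finite_dimensional (op_ker B))
    (hIII : J @` op_ker L `<=` dom L)
    (hIV : selfadjoint dot (hamiltonian L J)) :
  exists eps : R, 0 < eps /\
    spectrum (hamiltonian L J) `<=`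
      [set x%:C | x in `]-oo, - eps] `|` [set 0] `|` `[eps, +oo[ ].
Proof.
have [delta [delta0 hB]] := hI.
have L_sa : selfadjoint dot L by case: L_sqrt.
have s0 : 0 < Num.sqrt delta / 2 by rewrite divr_gt0 // sqrtr_gt0.
have Lgap y : dom L y -> orth dot (op_ker L) y ->
    Num.sqrt delta / 2 * nrm y <= nrm (L y).
  move=> dy yK; have := sqrt_gap hdot B_sa delta0 hB L_sqrt dy yK; lra.
have Kfin : finite_dimensional (op_ker L) by rewrite -(ker_sqrt hdot L_sqrt).
have [D D0 hD] := hamiltonian_gap hdot J_sqr L_sa s0 J_bounded Kfin Lgap
  (sqrt_range hdot B_sa delta0 hB L_sqrt).
exists D^-1; split=> [|z zH]; first by rewrite invr_gt0.
have z_real : complex.Im z = 0.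
  by apply: contrapT => /eqP z0; apply: zH; apply: (resolvent_nonreal hdot hIV z0).
case: z z_real zH => a b /= -> zH; exists a => //.
apply: contrapT => ha; apply: zH.
have a0 : a != 0 by apply/eqP => a0; apply: ha; left; right.
have aD : `|a| < D^-1.
  rewrite ltNge; apply/negP; rewrite ler_normr => /orP[aD|aD]; apply: ha.
    by right; rewrite /= in_itv /= andbT.
  by left; left; rewrite /= in_itv /= lerNr.
have [c c0 hc] := gap_bounded_below hdot hIV D0 a0 aD hD.
(* The point [a] is real, so one bound serves for it and for its conjugate. *)
apply: (resolvent_bounded_below hdot hIV c0) => x dx; first exact: hc.
by have := hc x dx; rewrite /= oppr0.
Qed.
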